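(* Let $X$ be a finite set and $\theta:[t_1,\infty)\to\Pi_X$ a sequence of partitions of $X$ with change points $t_1<\dots<t_M$. (i) If $\theta$ is hierarchical in $[s,t]$, then $\mathrm{HF}_0(s,t)=\min(|\theta(s)|,|\theta(t)|)$. As a special case, $\mathrm{HF}_0(t,t)=|\theta(t)|$ for all $t\ge t_1$. (ii) $\bar c_0(\theta)>0$ if and only if $\theta$ has a 0-conflict. (iii) Let $\theta$ be either coarse-graining or fine-graining. Then $\bar c_0(\theta)=0$ if and only if $\theta$ is strictly hierarchical.
   Context: $X=\{x_1,\dots,x_N\}$ is a finite set, $\Pi_X$ is the set of partitions of $X$ (into nonempty clusters), $|\pi|$ is the number of clusters of $\pi$. Refinement order: $\pi\le\pi'$ if every cluster of $\pi$ is contained in a cluster of $\pi'$. A sequence of partitions is a piecewise-constant map $\theta:[t_1,\infty)\to\Pi_X$ with change points $t_1<\dots<t_M$: $\theta(t)=\theta(t_m)$ for $t\in[t_m,t_{m+1})$, $1\le m\le M-1$, and $\theta(t)=\theta(t_M)$ for $t\ge t_M$. $\theta$ is hierarchical in $[s,t]$ if either $\theta(r_1)\le\theta(r_2)$ for all $r_1\le r_2$ in $[s,t]$, or $\theta(r_1)\ge\theta(r_2)$ for all $r_1\le r_2$ in $[s,t]$; it is strictly hierarchical if it is hierarchical in $[t_1,\infty)$ (same definition on this interval). $\theta$ is coarse-graining if $|\theta(s)|\ge|\theta(t)|$ for all $s\le t$, and fine-graining if $|\theta(s)|\le|\theta(t)|$ for all $s\le t$. For $t_1\le s\le t$, $K^{s,t}:=\bigcup_{s\le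 r\le t}\bigcup_{C\in\theta(r)}\Delta C$, where $\Delta C:=2^C$ is the solid simplex on $C$, and $\mathrm{HF}_0(s,t):=\dim H_0(K^{s,t})$ (homology over a fixed field), the number of connected components of $K^{s,t}$. $\theta$ has a 0-conflict in $[s,t]$ if the subposet $\theta([s,t])$ of $(\Pi_X,\le)$ has no maximum; $\theta$ has a 0-conflict if it has one in some $[s,t]$ with $t_1\le s\le t$. Average 0-conflict: with $T:=t_M+\frac{t_M-t_1}{M-1}$ (so $M\ge2$), $$\bar c_0(\theta):=1-\frac{2}{|T-t_1|^2}\int_{t_1}^{T}\int_{s}^{T}\frac{\mathrm{HF}_0(s,t)}{\min_{r\in[s,t]}\mathrm{HF}_0(r,r)}\,\mathrm{d}t\,\mathrm{d}s .$$ *)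

(* Defs.v *)
From HB Require Import structures.
From mathcomp Require Import all_boot all_order all_algebra.
From mathcomp Require Import all_classical all_reals all_analysis.

Set Implicit Arguments.
Unset Strict Implicit.
Unset Printing Implicit Defensive.

Import Order.TTheory GRing.Theory Num.Theory.
Import numFieldNormedType.Exports.

Local Open Scope ring_scope.

Section SimplicialHomology.
Variables (F : fieldType) (X : finType).

(* Simplices of all dimensions live in the single space F^(2^X); an abstract
   simplicial complex on X is a downward closed K : {set {set X}}, whose
   p-simplices are the members of cardinality p + 1.  Simplices are oriented
   by the enumeration order of X. *)
Definition chain := {ffun {set X} -> F^o}.

Definition simplex_chain (A : {set X}) : chain := [ffun B => (B == A)%:R].

(* The test on #|A| makes vertices cycles: the homology is not reduced. *)
Definition simplex_boundary (A : {set X}) : chain :=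
  if (#|A| <= 1)%N then 0 else
  \sum_(x in A)
    (-1) ^+ #|[set y in A | (enum_rank y < enum_rank x)%N]%SET|
      *: simplex_chain (A :\ x).

Definition boundary (c : chain) : chain :=
  \sum_(A : {set X}) (c A : F) *: simplex_boundary A.

Fact boundary_is_linear : linear boundary.
Proof.
move=> a c d; rewrite /boundary scaler_sumr -big_split /=.
by apply: eq_bigr => A _; rewrite !ffunE scalerDl -scalerA.
Qed.

HB.instance Definition _ :=
  GRing.isLinear.Build F chain chain *:%R boundary boundary_is_linear.

Definition chains (K : {set {set X}}) (p : nat) : {vspace chain} :=
  <<[seq simplex_chain A | A : {set X} <- enum K & #|A| == p.+1]>>%VS.

Definition cycles (K : {set {set X}}) (p : nat) : {vspace chain} :=
  (chains K p :&: lker (linfun boundary))%VS.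

Definition boundaries (K : {set {set X}}) (p : nat) : {vspace chain} :=
  (linfun boundary @: chains K p.+1)%VS.

(* dim (Z_p / B_p); the subtraction is not truncated since B_p <= Z_p for a
   downward closed K. *)
Definition dim_homology (K : {set {set X}}) (p : nat) : nat :=
  (\dim (cycles K p) - \dim (boundaries K p))%N.

End SimplicialHomology.

Section PartitionPoset.
Variable X : finType.

Record setpart := SetPart {
  clusters :> {set {set X}};
  _ : finset.partition clusters [set: X]%SET }.

HB.instance Definition _ := [isSub for clusters].
HB.instance Definition _ := [Finite of setpart by <:].

Definition refines (P Q : setpart) : bool :=
  [forall C in clusters P, exists D in clusters Q, C \subset D].

Fact refinesP (P Q : setpart) :
  reflect (forall C, C \in clusters P ->
             exists2 D, D \in clusters Q & C \subset D)
          (refines P Q).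
Proof.
by apply: (iffP forall_inP) => H C CP; apply/exists_inP; exact: H.
Qed.

Fact refines_refl : reflexive refines.
Proof. by move=> P; apply/refinesP => C CP; exists C. Qed.

Fact refines_trans : transitive refines.
Proof.
move=> Q P S /refinesP PQ /refinesP QS; apply/refinesP => C /PQ[D /QS[E ES DE] CD].
by exists E => //; exact: fintype.subset_trans CD DE.
Qed.

Fact refines_anti : antisymmetric refines.
Proof.
suff sub (P Q : setpart) : refines P Q -> refines Q P ->
    clusters P \subset clusters Q.
  move=> P Q /andP[PQ QP]; apply/val_inj/eqP.
  by rewrite finset.eqEsubset !sub.
move=> /refinesP PQ /refinesP QP; apply/fintype.subsetP => C CP.
have [D DQ CD] := PQ _ CP; have [E EP DE] := QP _ DQ.
case: P PQ QP CP EP => P /= /and3P[_ /finset.trivIsetP tP P0] _ _ CP EP.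
have CE : C \subset E by exact: fintype.subset_trans CD DE.
have eCE : C = E.
  apply/eqP; apply: contraNT P0 => /(tP _ _ CP EP).
  rewrite -finset.setI_eq0 (finset.setIidPl CE) => /eqP C0.
  by rewrite -C0.
suff -> : C = D by [].
by apply/eqP; rewrite finset.eqEsubset CD eCE DE.
Qed.

HB.instance Definition _ := Order.Le_isPOrder.Build Order.default_display
  setpart refines_refl refines_anti refines_trans.

End PartitionPoset.

Section PartitionSequences.
Variables (R : realType) (F : fieldType) (X : finType).

(* The change points are tp 1 < ... < tp M; other values of tp, and the values
   of theta before tp 1, are irrelevant. *)
Definition partition_sequence (M : nat) (tp : nat -> R)
    (theta : R -> setpart X) : Prop :=
  [/\ (0 < M)%N,
      forall m : nat, (0 < m < M)%N -> tp m < tp m.+1,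
      forall m : nat, (0 < m < M)%N ->
        forall t, tp m <= t < tp m.+1 -> theta t = theta (tp m)
    & forall t, tp M <= t -> theta t = theta (tp M)].

Definition hierarchical (theta : R -> setpart X) (i : interval R) : Prop :=
  (forall r1 r2, r1 \in i -> r2 \in i -> r1 <= r2 ->
     (theta r1 <= theta r2)%O) \/
  (forall r1 r2, r1 \in i -> r2 \in i -> r1 <= r2 ->
     (theta r2 <= theta r1)%O).

Definition strictly_hierarchical (t1 : R) (theta : R -> setpart X) : Prop :=
  hierarchical theta `[t1, +oo[.

Definition coarse_graining (t1 : R) (theta : R -> setpart X) : Prop :=
  forall s t, t1 <= s -> s <= t -> (#|theta t| <= #|theta s|)%N.

Definition fine_graining (t1 : R) (theta : R -> setpart X) : Prop :=
  forall s t, t1 <= s -> s <= t -> (#|theta s| <= #|theta t|)%N.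

(* The empty set belongs to powerset C but is not a p-simplex for any p. *)
Definition conflict_complex (theta : R -> setpart X) (s t : R) :
    {set {set X}} :=
  [set A | `[< exists2 r, r \in `[s, t] &
                 exists2 C, C \in clusters (theta r) & A \in powerset C >]]%SET.

Definition HF0 (theta : R -> setpart X) (s t : R) : nat :=
  dim_homology F (conflict_complex theta s t) 0.

Definition has_maximum (S : set (setpart X)) : Prop :=
  exists2 P, S P & forall Q, S Q -> (Q <= P)%O.

Definition conflict0_in (theta : R -> setpart X) (s t : R) : Prop :=
  ~ has_maximum (theta @` `[s, t])%classic.

Definition conflict0 (t1 : R) (theta : R -> setpart X) : Prop :=
  exists s t, [/\ t1 <= s, s <= t & conflict0_in theta s t].

(* An infimum of a nonempty set of natural numbers (for s <= t), hence a
   minimum. *)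
Definition min_HF0 (theta : R -> setpart X) (s t : R) : R :=
  inf ((fun r => (HF0 theta r r)%:R : R) @` `[s, t])%classic.

Definition average_conflict0 (M : nat) (tp : nat -> R)
    (theta : R -> setpart X) : R :=
  let t1 := tp 1%N in
  let T := tp M + (tp M - t1) / (M - 1)%:R in
  1 - 2 / `|T - t1| ^+ 2 *
    \int[lebesgue_measure]_(s in [set` `[t1, T]])
      \int[lebesgue_measure]_(t in [set` `[s, T]])
        ((HF0 theta s t)%:R / min_HF0 theta s t).

End PartitionSequences.

(* Main.v *)
From HB Require Import structures.
Require Import Defs.
From mathcomp Require Import all_boot all_order all_algebra.
From mathcomp Require Import all_classical all_reals all_analysis.
From mathcomp Require Import lra ring.

(** Write [vertex x] for the 0-simplex on [x] and let W(P), for a partition P,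
    be the space of all vertex chains whose coefficients sum to zero over each
    cluster of P.  It is spanned by the differences [vertex x - vertex y] with
    [x] and [y] in a common cluster, it has dimension #|X| - #|P|, and
    P |-> W(P) embeds the refinement order into the inclusion order
    ([dim_cluster_space], [cluster_space_le]).  In the conflict complex every
    vertex chain is a cycle, and the edges are the pairs inside a cluster of
    some theta(r), so that the boundaries form the sum of the W(theta(r)) over
    r in [s, t] ([boundaries_conflict_complex_subP]).  Hence HF0(s, t) is the
    codimension of this sum, which is at most #|theta(r)| for every r in [s, t]
    with equality exactly when W(theta(r)) contains all the other summands,
    that is, when theta(r) is the maximum of theta([s, t]).  This is
    [HF0_leqif], from which all three assertions follow.

    (i) If theta is hierarchical in [s, t], one of the two end points carries
    the maximum, and coarser partitions have fewer clusters.

    (ii) The integrand HF0(s, t) / min HF0(r, r) is at most 1; it equals 1 when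
    theta([s, t]) has a maximum, and it is at most 1 - 1 / #|X| otherwise.
    Without conflicts the double integral is therefore the area
    (T - t_1)^2 / 2 of the triangle.  A conflict in [s, t] may be assumed to
    have t <= t_M < T, because theta is constant from t_M on; since theta is
    constant to the right of s and of t, the conflict persists on a square
    above (s, t), and the double integral falls short of the area of the
    triangle by at least the area of this square divided by #|X|
    ([conflict0_rectangle], [le_Rintegral_rect]).

    (iii) By (ii), the average vanishes if and only if every theta([s, t]) has
    a maximum.  For a coarse-graining theta the maximum has at least as many
    clusters as theta(t), which refines it, and so equals theta(t); for a
    fine-graining theta it equals theta(s) in the same way. *)

Set Implicit Arguments.
Unset Strict Implicit.
Unset Printing Implicit Defensive.

Import Order.TTheory GRing.Theory Num.Theory.
Import numFieldNormedType.Exports.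
Local Open Scope ring_scope.

(** * The space of chains that vanish on the clusters of a partition *)

Section ClusterSpaces.
Variables (F : fieldType) (X : finType).
Implicit Types (P Q : setpart X) (x y : X).

Lemma simplex_chainE (A B : {set X}) :
  simplex_chain F A B = (B == A)%:R.
Proof. by rewrite ffunE. Qed.

Lemma simplex_chain_inj : injective (@simplex_chain F X).
Proof.
move=> A B /ffunP/(_ A); rewrite !simplex_chainE eqxx.
by case: eqP => // _ /eqP; rewrite oner_eq0.
Qed.

Lemma simplex_chain_free (s : seq {set X}) :
  uniq s -> free [seq simplex_chain F A | A <- s].
Proof.
move=> us; apply/(@freeP _ _ _ (in_tuple _)) => k /= k0 i.
have := congr1 (fun c : chain F X => (c (nth finset.set0 s i) : F)) k0.
have si (j : 'I_(size [seq simplex_chain F A | A <- s])) : (j < size s)%N.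
  by rewrite -(size_map (@simplex_chain F X)).
rewrite /= sum_ffunE ffunE (bigD1 i) //= big1 ?addr0 => [|j ji].
  rewrite (nth_map finset.set0) ?si // ffunE simplex_chainE eqxx.
  by rewrite /GRing.scale /= mulr1.
rewrite (nth_map finset.set0) ?si // ffunE simplex_chainE.
by rewrite nth_uniq ?si // eq_sym (inj_eq val_inj) (negPf ji) scaler0.
Qed.

Definition vertex x : chain F X := simplex_chain F (finset.set1 x).

Definition vertex_space : {vspace chain F X} :=
  <<[seq vertex x | x <- enum X]>>%VS.

Lemma memv_vertex x : vertex x \in vertex_space.
Proof. by apply/memv_span/map_f; rewrite mem_enum. Qed.

Lemma dim_vertex_space : \dim vertex_space = #|X|.
Proof.
have /eqP-> : free [seq vertex x | x <- enum X].
  rewrite (map_comp (@simplex_chain F X)) simplex_chain_free //.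
  by rewrite map_inj_uniq ?enum_uniq //; exact: finset.set1_inj.
by rewrite size_map cardE.
Qed.

Lemma vertex_space_sum c : c \in vertex_space ->
  c = \sum_x (c (finset.set1 x) : F) *: vertex x.
Proof.
move=> cV.
have [k ->] : exists k : X -> F, c = \sum_x k x *: vertex x.
  move: cV; rewrite /vertex_space span_def big_map big_enum /=.
  case/memv_sumP => v vx ->.
  have /choice[k kP] : forall x, exists a : F, v x = a *: vertex x.
    by move=> x; apply/vlineP; exact: vx.
  by exists k; apply: eq_bigr.
apply: eq_bigr => x _; congr (_ *: _).
rewrite sum_ffunE (bigD1 x) //= big1 ?addr0 => [|y yx].
  by rewrite ffunE simplex_chainE eqxx /GRing.scale /= mulr1.
rewrite ffunE simplex_chainE (inj_eq finset.set1_inj).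
by rewrite eq_sym (negPf yx) scaler0.
Qed.

(** Sends a vertex to the cluster of [P] that contains it, so that the
    coefficient of [collapse P c] at a cluster is the sum of the coefficients of
    [c] over that cluster. *)
Definition collapse P (c : chain F X) : chain F X :=
  \sum_x (c (finset.set1 x) : F) *: simplex_chain F (finset.pblock P x).

Fact collapse_is_linear P : linear (collapse P).
Proof.
move=> a c d; rewrite /collapse scaler_sumr -big_split /=.
by apply: eq_bigr => x _; rewrite !ffunE scalerDl -scalerA.
Qed.

HB.instance Definition _ P :=
  GRing.isLinear.Build F (chain F X) (chain F X) *:%R (collapse P)
    (collapse_is_linear P).

Lemma collapse_vertex P x :
  collapse P (vertex x) = simplex_chain F (finset.pblock P x).
Proof.
rewrite /collapse (bigD1 x) //= big1 ?addr0 => [|y yx].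
  by rewrite simplex_chainE eqxx scale1r.
by rewrite simplex_chainE (inj_eq finset.set1_inj) (negPf yx) scale0r.
Qed.

Definition cluster_space P : {vspace chain F X} :=
  (vertex_space :&: lker (linfun (collapse P)))%VS.

Lemma setpart_partition P : finset.partition P [set: X]%SET.
Proof. exact: (valP P). Qed.

Lemma setpart_cover P : finset.cover P = [set: X]%SET.
Proof. by case/and3P: (setpart_partition P) => /eqP. Qed.

Lemma setpart_trivIset P : finset.trivIset P.
Proof. by case/and3P: (setpart_partition P). Qed.

Lemma pblock_in P x : finset.pblock P x \in clusters P.
Proof. by apply: pblock_mem; rewrite setpart_cover finset.inE. Qed.

Lemma mem_pblock_self P x : x \in finset.pblock P x.
Proof. by rewrite finset.mem_pblock setpart_cover finset.inE. Qed.

Lemma eq_pblock_cluster P x y :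
  (finset.pblock P x == finset.pblock P y) = (y \in finset.pblock P x).
Proof. by rewrite eq_pblock ?setpart_trivIset ?setpart_cover ?finset.inE. Qed.

Lemma pblock_cluster P C x :
  C \in clusters P -> x \in C -> finset.pblock P x = C.
Proof. exact: def_pblock (setpart_trivIset P). Qed.

Lemma cluster_neq0 P C : C \in clusters P -> exists x, x \in C.
Proof.
case/and3P: (setpart_partition P) => _ _ P0 CP.
by apply/finset.set0Pn; apply: contraNneq P0 => <-.
Qed.

Lemma refines_pblock P Q :
  (P <= Q)%O <-> forall x y, y \in finset.pblock P x -> y \in finset.pblock Q x.
Proof.
split=> [/refinesP PQ x y|PQ].
  have [D DQ /fintype.subsetP CD] := PQ _ (pblock_in P x).
  by move/CD; rewrite -(pblock_cluster DQ (CD _ (mem_pblock_self P x))).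
apply/refinesP => C CP; have [x xC] := cluster_neq0 CP.
exists (finset.pblock Q x); first exact: pblock_in.
apply/fintype.subsetP => y; rewrite -(pblock_cluster CP xC); exact: PQ.
Qed.

(** Rank-nullity for [collapse P], which maps the vertices onto the clusters. *)
Lemma dim_cluster_space P : (\dim (cluster_space P) + #|P| = #|X|)%N.
Proof.
rewrite -dim_vertex_space -(limg_ker_dim (linfun (collapse P)) vertex_space).
congr (_ + _)%N; rewrite limg_span.
rewrite (eq_span (Y := [seq simplex_chain F C | C <- enum (clusters P)])).
  have /eqP-> := simplex_chain_free (enum_uniq (clusters P)).
  by rewrite size_map cardE.
move=> c; apply/mapP/mapP => [[_ /mapP[x _ ->] ->]|[C]].
  exists (finset.pblock P x); first by rewrite mem_enum pblock_in.
  by rewrite lfunE /= collapse_vertex.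
rewrite mem_enum => CP ->; have [x xC] := cluster_neq0 CP.
exists (vertex x); first by rewrite map_f // mem_enum.
by rewrite lfunE /= collapse_vertex (pblock_cluster CP xC).
Qed.

Lemma mem_cluster_space P x y :
  (vertex x - vertex y \in cluster_space P) = (y \in finset.pblock P x).
Proof.
rewrite memv_cap rpredB ?memv_vertex //= memv_ker lfunE /= linearB /=.
rewrite !collapse_vertex subr_eq0 -eq_pblock_cluster.
exact: inj_eq simplex_chain_inj _ _.
Qed.

(** This is the spanning property of the differences of vertices: choose a
    representative of each cluster; when the coefficients of [c] sum to zero
    over every cluster, replacing each vertex by its representative turns
    [c] into 0, so [c] is a combination of differences between a vertex and its
    representative. *)
Lemma cluster_space_subP P (U : {vspace chain F X}) :
  reflect (forall x y, y \in finset.pblock P x -> vertex x - vertex y \in U)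
          (cluster_space P <= U)%VS.
Proof.
apply: (iffP subvP) => [PU x y xy|H c].
  by apply: PU; rewrite mem_cluster_space.
rewrite memv_cap memv_ker lfunE /= => /andP[/vertex_space_sum c_sum /eqP c0].
pose rep (C : {set X}) := if [pick y in C] is Some y then vertex y else 0.
have -> : c =
    \sum_x (c (finset.set1 x) : F) *: (vertex x - rep (finset.pblock P x)).
  under eq_bigr do rewrite scalerBr.
  rewrite big_split /= -c_sum sumrN (partition_big (finset.pblock P) predT) //=.
  rewrite big1 ?subr0 // => C _.
  (* The total coefficient of the representative of C is the coefficient at C
     of collapse P c, which is 0. *)
  have := congr1 (fun d : chain F X => (d C : F) *: rep C) c0.
  rewrite /= ffunE scale0r /collapse sum_ffunE => {2}<-.
  rewrite scaler_suml big_mkcond; apply: eq_bigr => x _.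
  rewrite ffunE simplex_chainE eq_sym.
  by case: eqP => [->|_]; rewrite ?scaler0 ?scale0r // /GRing.scale /= mulr1.
apply: rpred_sum => x _; apply: rpredZ.
rewrite /rep; case: pickP => [y /H//|/(_ x)].
by rewrite mem_pblock_self.
Qed.

Lemma cluster_space_le P Q :
  (cluster_space P <= cluster_space Q)%VS = (P <= Q)%O.
Proof.
apply/cluster_space_subP/idP => [PQ|/refines_pblock PQ x y].
  apply/refines_pblock => x y /PQ; by rewrite mem_cluster_space.
by move/PQ; rewrite mem_cluster_space.
Qed.

(** Which end point comes first in the enumeration of [X] only affects the
    sign, which no subspace notices. *)
Lemma edge_boundary x y : x != y -> exists b : bool,
  simplex_boundary F [set x; y]%SET = (-1) ^+ b *: (vertex x - vertex y).
Proof.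
wlog xy : x y / (enum_rank x < enum_rank y)%N => [wl xney|xney].
  case: (ltngtP (enum_rank x) (enum_rank y)) => [/wl|/wl|]; first exact.
    rewrite eq_sym finset.setUC => /(_ xney)[b ->]; exists (~~ b).
    rewrite -[vertex x - _]opprB scalerN -scaleNr.
    by case: b; rewrite ?expr0 ?expr1 ?opprK.
  by move/val_inj/enum_rank_inj => xy; rewrite xy eqxx in xney.
exists true; rewrite /simplex_boundary cards2 xney /=.
rewrite big_setU1 ?finset.inE //= big_set1.
have -> : [set z in [set x; y] | (enum_rank z < enum_rank x)%N]%SET =
    finset.set0.
  apply/finset.setP => z; rewrite !finset.inE.
  by apply/negP => /andP[/orP[]/eqP->]; rewrite ?ltnn // ltnNge (ltnW xy).
have -> : [set z in [set x; y] | (enum_rank z < enum_rank y)%N]%SET =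
    [set x]%SET.
  apply/finset.setP => z; rewrite !finset.inE.
  case: (eqVneq z x) => [->|zx] /=; first by rewrite xy.
  by case: eqP => [->|]; rewrite ?ltnn.
rewrite cards0 cards1 expr0 scale1r expr1.
have -> : ([set x; y] :\ x = [set y])%SET.
  by rewrite finset.setU1K // finset.inE.
have -> : ([set x; y] :\ y = [set x])%SET.
  by rewrite finset.setUC finset.setU1K // finset.inE eq_sym.
by rewrite !scaleN1r opprB.
Qed.

Lemma boundary_simplex (A : {set X}) :
  boundary (simplex_chain F A) = simplex_boundary F A.
Proof.
rewrite /boundary (bigD1 A) //= big1 ?addr0 => [|B BA].
  by rewrite simplex_chainE eqxx scale1r.
by rewrite simplex_chainE (negPf BA) scale0r.
Qed.

Lemma boundary_vertex x : boundary (vertex x) = 0.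
Proof. by rewrite boundary_simplex /simplex_boundary cards1. Qed.

Section HomologyDegree0.
Variable K : {set {set X}}.
Hypothesis vertexK : forall x, [set x]%SET \in K.

Lemma cycles0E : cycles F K 0 = vertex_space.
Proof.
rewrite /cycles; have -> : chains F K 0 = vertex_space.
  apply: eq_span => c; apply/mapP/mapP => [[A]|[x _ ->]].
    rewrite mem_filter => /andP[/cards1P[x ->] _] ->.
    by exists x; rewrite ?mem_enum.
  by exists [set x]%SET; rewrite // mem_filter cards1 mem_enum vertexK.
apply/capv_idPl/span_subvP => _ /mapP[x _ ->].
by rewrite memv_ker lfunE /= boundary_vertex.
Qed.

Lemma boundaries0_subP (U : {vspace chain F X}) :
  reflect (forall x y, [set x; y]%SET \in K -> vertex x - vertex y \in U)
          (boundaries F K 0 <= U)%VS.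
Proof.
rewrite /boundaries limg_span; apply: (iffP span_subvP) => KU.
  move=> x y xyK.
  have [->|/[dup] xy /edge_boundary[b xyE]] := eqVneq x y.
    by rewrite subrr mem0v.
  rewrite -(rpredZsign _ b) -xyE -boundary_simplex; apply: KU.
  apply/mapP; exists (simplex_chain F [set x; y]%SET); last by rewrite lfunE.
  by rewrite map_f // mem_filter cards2 xy mem_enum.
move=> _ /mapP[_ /mapP[A AK ->] ->]; move: AK.
rewrite mem_filter mem_enum => /andP[/cards2P[x [y [xy ->]]] xyK].
rewrite lfunE /= boundary_simplex; have [b ->] := edge_boundary xy.
by rewrite rpredZsign KU.
Qed.
End HomologyDegree0.
End ClusterSpaces.

(** * Homology of the conflict complex in degree 0 *)

Section ConflictComplex.
Variables (R : realType) (F : fieldType) (X : finType).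
Implicit Types (theta : R -> setpart X) (r s t : R).

Lemma conflict_complexP theta s t (A : {set X}) :
  reflect (exists2 r, r \in `[s, t] &
             exists2 C, C \in clusters (theta r) & A \subset C)
          (A \in conflict_complex theta s t).
Proof.
rewrite finset.inE; apply: (iffP (asboolP _)) => -[r rst [C CP sAC]];
  by exists r => //; exists C => //; move: sAC; rewrite powersetE.
Qed.

(** The space of boundaries is characterised as the least upper bound of the
    cluster spaces, which avoids a sum indexed by an interval of reals. *)
Lemma boundaries_conflict_complex_subP theta s t (U : {vspace chain F X}) :
  (boundaries F (conflict_complex theta s t) 0 <= U)%VS <->
  forall r, r \in `[s, t] -> (cluster_space F (theta r) <= U)%VS.
Proof.
split=> [/boundaries0_subP BU r rst|WU].
  apply/cluster_space_subP => x y xy; apply: BU.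
  apply/conflict_complexP; exists r => //.
  exists (finset.pblock (theta r) x); first exact: pblock_in.
  apply/fintype.subsetP => z; rewrite !finset.inE => /orP[]/eqP-> //.
  exact: mem_pblock_self.
apply/boundaries0_subP => x y.
move=> /conflict_complexP[r rst [C CP /fintype.subsetP xyC]].
have /cluster_space_subP := WU _ rst; apply.
have xC : x \in C by rewrite xyC // !finset.inE eqxx.
by rewrite (pblock_cluster CP xC) xyC // !finset.inE eqxx orbT.
Qed.

Lemma HF0E theta s t : s <= t ->
  (HF0 F theta s t +
     \dim (boundaries F (conflict_complex theta s t) 0))%N = #|X|.
Proof.
move=> st; rewrite /HF0 /dim_homology cycles0E ?dim_vertex_space.
  rewrite subnK // -(dim_vertex_space F) dimvS //.
  apply/boundaries_conflict_complex_subP => r _; exact: capvSl.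
move=> x; apply/conflict_complexP; exists s; first by rewrite in_itv /= lexx.
exists (finset.pblock (theta s) x); first exact: pblock_in.
by rewrite finset.sub1set mem_pblock_self.
Qed.

(** Both sides are codimensions in the space of vertices: of the boundaries on
    the left, of one cluster space contained in them on the right. *)
Lemma HF0_leqif theta r s t : r \in `[s, t] ->
  (HF0 F theta s t <= #|theta r| ?= iff
    `[< forall r', r' \in `[s, t] -> (theta r' <= theta r)%O >])%N.
Proof.
move=> rst; have st : s <= t.
  by move: rst; rewrite in_itv /= => /andP[]; exact: le_trans.
set B := boundaries F (conflict_complex theta s t) 0.
have WB : (cluster_space F (theta r) <= B)%VS.
  by have /boundaries_conflict_complex_subP := subvv B; apply.
have -> : `[< forall r', r' \in `[s, t] -> (theta r' <= theta r)%O >] =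
  (B <= cluster_space F (theta r))%VS.
  apply/asboolP/idP => [max_r|/boundaries_conflict_complex_subP max_r].
    apply/boundaries_conflict_complex_subP => r' /max_r.
    by rewrite cluster_space_le.
  by move=> r' /max_r; rewrite cluster_space_le.
have [le_dim eq_dim] := dimv_leqif_sup WB.
have := HF0E theta st; have := dim_cluster_space F (theta r).
rewrite -/B -{}eq_dim => dimW dimB; split.
  by rewrite -(leq_add2r (\dim (cluster_space F (theta r)))) [leqRHS]addnC dimW
    -dimB leq_add2l.
rewrite -(eqn_add2r (\dim (cluster_space F (theta r)))) [X in _ == X]addnC dimW.
by rewrite -dimB eqn_add2l.
Qed.

Lemma HF0_le_card theta r s t : r \in `[s, t] ->
  (HF0 F theta s t <= #|theta r|)%N.
Proof. by case/(HF0_leqif theta). Qed.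

Lemma HF0_max theta r s t : r \in `[s, t] ->
  (forall r', r' \in `[s, t] -> (theta r' <= theta r)%O) ->
  HF0 F theta s t = #|theta r|.
Proof.
by move=> /(HF0_leqif theta)[_ +] /asboolP max_r; rewrite max_r => /eqP.
Qed.

Lemma HF0_diag theta t : HF0 F theta t t = #|theta t|.
Proof.
apply: HF0_max => [|r]; rewrite in_itv /=; first by rewrite lexx.
by rewrite -eq_le => /eqP->.
Qed.

Lemma card_refines (P Q : setpart X) : (P <= Q)%O -> (#|Q| <= #|P|)%N.
Proof.
rewrite -(cluster_space_le F) => /dimvS.
rewrite -(leq_add2r #|P|) dim_cluster_space -(dim_cluster_space F Q).
by rewrite leq_add2l.
Qed.

Lemma HF0_hierarchical theta s t : s <= t -> hierarchical theta `[s, t] ->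
  HF0 F theta s t = minn #|theta s| #|theta t|.
Proof.
move=> st; have sst : s \in `[s, t] by rewrite in_itv /= lexx.
have tst : t \in `[s, t] by rewrite in_itv /= lexx andbT.
case=> mono.
  rewrite (HF0_max tst) => [|r rst].
    by apply/esym/minn_idPr/card_refines/mono.
  by apply: mono => //; move: rst; rewrite in_itv => /andP[].
rewrite (HF0_max sst) => [|r rst].
  by apply/esym/minn_idPl/card_refines/mono.
by apply: mono => //; move: rst; rewrite in_itv => /andP[].
Qed.

End ConflictComplex.

(** * Integrals over triangles *)

(** The integral of a nonnegative function is the supremum of the integrals of
    the simple functions below it, so it is monotone even where [f] is not
    measurable; [f] will be an integrand about which only bounds are known. *)
Lemma ge0_le_Rintegral d (T : measurableType d) (R : realType)
    (mu : {measure set T -> \bar R}) (D : set T) (f g : T -> R) :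
  measurable D ->
  (forall x, D x -> 0 <= f x <= g x) -> mu.-integrable D (EFin \o g) ->
  \int[mu]_(x in D) f x <= \int[mu]_(x in D) g x.
Proof.
move=> mD fg ig.
have f0 x : D x -> (0 <= (f x)%:E)%E by move=> /fg/andP[+ _]; rewrite lee_fin.
have g0 x : D x -> (0 <= (g x)%:E)%E.
  by move=> /fg/andP[f0x fgx]; rewrite lee_fin (le_trans f0x).
have le_fg : (\int[mu]_(x in D) (f x)%:E <= \int[mu]_(x in D) (g x)%:E)%E.
  rewrite !ge0_integralE //; apply: le_ereal_sup => _ [h hf <-]; exists h => //.
  move=> x; apply: le_trans (hf x) _; apply: lee_restrict => y Dy.
  by rewrite lee_fin; case/andP: (fg _ Dy).
have gfin := integrable_fin_num mD ig.
apply: fine_le => //; rewrite ge0_fin_numE ?integral_ge0 //.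
by apply: le_lt_trans le_fg _; rewrite -ge0_fin_numE ?integral_ge0.
Qed.

Section Integrals.
Variable R : realType.
Local Notation mu := (@lebesgue_measure R).

Lemma lebesgue_measure_segment (a b : R) : a <= b ->
  fine (lebesgue_measure `[a, b]%classic) = b - a.
Proof.
by move=> ab; rewrite lebesgue_measure_itv /= lte_fin; case: ltP => //= ?; lra.
Qed.

Lemma integrable_cst_itv (a b k : R) :
  mu.-integrable `[a, b] (EFin \o cst k).
Proof.
apply: continuous_compact_integrable; first exact: segment_compact.
by apply: continuous_subspaceT => x; exact: cst_continuous.
Qed.

Lemma integrable_scale_indic (a b c d k : R) :
  mu.-integrable `[a, b] (EFin \o (fun x => k * \1_(`[c, d]%classic) x)).
Proof.
have -> : EFin \o (fun x => k * \1_(`[c, d]%classic) x) =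
    (fun x => k%:E * (EFin \o \1_(`[c, d]%classic)) x)%E by [].
apply: integrableZl => //.
by apply: integrableS (integrable_indic_itv c d true false).
Qed.

Lemma Rintegral_scale_indic (a b c d k : R) : a <= c -> c <= d -> d <= b ->
  \int[mu]_(x in `[a, b]) (k * \1_(`[c, d]%classic) x) = k * (d - c).
Proof.
move=> ac cd db; rewrite RintegralZl //; last first.
  by apply: integrableS (integrable_indic_itv c d true false).
congr (_ * _); rewrite /Rintegral integral_indic //.
have -> : (`[c, d] `&` `[a, b])%classic = `[c, d]%classic.
  apply/seteqP; split=> [x []//|x cdx]; split => //; move: cdx.
  rewrite /= !in_itv /= => /andP[cx xd].
  by rewrite (le_trans ac) ?(le_trans xd).
exact: lebesgue_measure_segment.
Qed.

Lemma Rintegral_cst1 (a b : R) : a <= b -> \int[mu]_(x in `[a, b]) 1 = b - a.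
Proof.
move=> ab; rewrite Rintegral_cst // mul1r; exact: lebesgue_measure_segment.
Qed.

Lemma continuous_affine (b : R) : continuous (fun x : R => b - x).
Proof. by move=> x; apply: cvgB; [exact: cvg_cst|exact: cvg_id]. Qed.

Lemma integrable_affine (a b : R) :
  mu.-integrable `[a, b] (EFin \o (fun x => b - x)).
Proof.
apply: continuous_compact_integrable; first exact: segment_compact.
by apply: continuous_subspaceT; exact: continuous_affine.
Qed.

Lemma Rintegral_affine (a b : R) : a < b ->
  \int[mu]_(x in `[a, b]) (b - x) = (b - a) ^+ 2 / 2.
Proof.
move=> ab; pose G x : R := b * x - 2^-1 * x ^+ 2.
have dG (x : R) : is_derive x (1 : R) G (b - x).
  by rewrite /G; apply: is_derive_eq; rewrite /GRing.scale /=; lra.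
have cG (y : R) : {for y, continuous G}.
  by apply: differentiable_continuous; apply/derivable1_diffP; exact: ex_derive.
rewrite /Rintegral (@continuous_FTC2 _ _ G) //=.
- rewrite /G; lra.
- by apply: continuous_subspaceT; exact: continuous_affine.
- split; first by move=> x _; exact: ex_derive.
  + exact/cvg_at_right_filter/cG.
  + exact/cvg_at_left_filter/cG.
- by move=> x _; rewrite derive1E derive_val.
Qed.

(** The square with sides [c, c + e] and [d, d + e] lies in the triangle
    a <= s <= t <= b because c + e <= d, and on it rho loses at least k. *)
Lemma le_Rintegral_rect (rho : R -> R -> R) (a b c d e k : R) :
  a <= c -> c < c + e -> c + e <= d -> d + e <= b ->
  (forall s t, a <= s -> s <= t -> t <= b -> 0 <= rho s t <= 1) ->
  (forall s t, s \in `[c, c + e] -> t \in `[d, d + e] -> rho s t <= 1 - k) ->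
  \int[mu]_(s in `[a, b]) \int[mu]_(t in `[s, b]) rho s t <=
    (b - a) ^+ 2 / 2 - k * e ^+ 2.
Proof.
move=> ac e0 ced deb rho01 rhok.
set J := `[c, c + e]%classic.
have ab : a < b by lra.
have -> : (b - a) ^+ 2 / 2 - k * e ^+ 2 =
    \int[mu]_(s in `[a, b]) ((b - s) - (k * e) * \1_J s).
  rewrite RintegralB //;
    [|exact: integrable_affine|exact: integrable_scale_indic].
  by rewrite Rintegral_affine // Rintegral_scale_indic //; [ring|lra|lra].
apply: ge0_le_Rintegral => // [s|]; last first.
  exact: integrableB (integrable_affine _ _) (integrable_scale_indic _ _ _ _ _).
rewrite /= in_itv /= => /andP[as_ sb]; apply/andP; split.
  apply: Rintegral_ge0 => t /=; rewrite in_itv /= => /andP[st tb].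
  by case/andP: (rho01 _ _ as_ st tb).
have [sJ|sJ] := boolP (s \in J); last first.
  rewrite indicE (negPf sJ) mulr0 subr0 -Rintegral_cst1 //.
  apply: ge0_le_Rintegral => // [t|]; last exact: integrable_cst_itv.
  by rewrite /= in_itv /= => /andP[st tb]; exact: rho01.
rewrite indicE sJ mulr1.
have /andP[cs sce] : c <= s <= c + e by move: sJ; rewrite inE /J /= in_itv.
(* In this column rho is bounded by 1 - k on [d, d + e] and by 1 elsewhere. *)
have -> : b - s - k * e =
    \int[mu]_(t in `[s, b]) (1 - k * \1_(`[d, d + e]%classic) t).
  rewrite RintegralB //;
    [|exact: integrable_cst_itv|exact: integrable_scale_indic].
  by rewrite Rintegral_cst1 // Rintegral_scale_indic //; [ring|lra|lra].
apply: ge0_le_Rintegral => // [t|]; last first.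
  exact: integrableB (integrable_cst_itv _ _ 1)
    (integrable_scale_indic _ _ _ _ _).
rewrite /= in_itv /= => /andP[st tb].
case/andP: (rho01 _ _ as_ st tb) => -> rho1 /=.
rewrite indicE; case: (boolP (t \in _)) => [|_]; last by rewrite mulr0 subr0.
by rewrite inE /= => td; rewrite mulr1 rhok //; rewrite in_itv /= cs.
Qed.

Lemma Rintegral_triangle1 (rho : R -> R -> R) (a b : R) : a < b ->
  (forall s t, a <= s -> s <= t -> rho s t = 1) ->
  \int[mu]_(s in `[a, b]) \int[mu]_(t in `[s, b]) rho s t = (b - a) ^+ 2 / 2.
Proof.
move=> ab rho1; rewrite -Rintegral_affine //; apply: eq_Rintegral => s.
rewrite inE /= in_itv /= => /andP[as_ sb]; rewrite -Rintegral_cst1 //.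
apply: eq_Rintegral => t; rewrite inE /= in_itv /= => /andP[st tb].
exact: rho1.
Qed.

End Integrals.

(** * The integrand of the average conflict *)

Section ConflictRatio.
Variables (R : realType) (F : fieldType) (X : finType).
Implicit Types (theta : R -> setpart X) (r s t : R).

Definition conflict_ratio theta s t : R :=
  (HF0 F theta s t)%:R / min_HF0 F theta s t.

(** The values over which the infimum is taken are natural numbers, so it is a
    minimum. *)
Lemma min_HF0_attained theta s t : s <= t ->
  exists2 r, r \in `[s, t] & min_HF0 F theta s t = #|theta r|%:R /\
    forall r', r' \in `[s, t] -> (#|theta r| <= #|theta r'|)%N.
Proof.
move=> st; pose p n := `[< exists2 r, r \in `[s, t] & #|theta r| = n >].
have exp : exists n, p n.
  by exists #|theta s|; apply/asboolP; exists s; rewrite // in_itv /= lexx.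
case: (ex_minnP exp) => _ /asboolP[r rst <-] min_r; exists r => //.
have min_card r' : r' \in `[s, t] -> (#|theta r| <= #|theta r'|)%N.
  by move=> r'st; apply: min_r; apply/asboolP; exists r'.
split=> //; apply/eqP; rewrite eq_le /min_HF0; apply/andP; split.
  apply: ge_inf; last by exists r; rewrite ?HF0_diag.
  by exists 0 => _ [u _ <-]; exact: ler0n.
apply: lb_le_inf; first by eexists; exists r; first exact: rst.
by move=> _ [u ust <-]; rewrite HF0_diag ler_nat; exact: min_card.
Qed.

Lemma card_setpart_gt0 (P : setpart X) : (0 < #|X|)%N -> (0 < #|P|)%N.
Proof.
case/card_gt0P => x _; apply/card_gt0P.
by exists (finset.pblock P x); exact: pblock_in.
Qed.

Lemma card_setpart_le (P : setpart X) : (#|P| <= #|X|)%N.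
Proof. by rewrite -(dim_cluster_space F P) leq_addl. Qed.

Lemma conflict_ratio01 theta s t : s <= t ->
  0 <= conflict_ratio theta s t <= 1.
Proof.
move=> st; have [r rst [min_r _]] := min_HF0_attained theta st.
rewrite /conflict_ratio min_r divr_ge0 //=.
have [->|n0] := eqVneq #|theta r| 0%N; first by rewrite invr0 mulr0.
by rewrite ler_pdivrMr ?ltr0n ?lt0n // mul1r ler_nat HF0_le_card.
Qed.

Lemma conflict_ratio1 theta s t : (0 < #|X|)%N -> s <= t ->
  ~ conflict0_in theta s t -> conflict_ratio theta s t = 1.
Proof.
move=> X0 st /contrapT[_ [u ust <-] max_u].
have [r rst [min_r min_card]] := min_HF0_attained theta st.
rewrite /conflict_ratio min_r (@HF0_max _ _ _ _ u) //; last first.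
  by move=> r' r'st; apply: max_u; exists r'.
suff -> : #|theta u| = #|theta r|.
  by rewrite divff // pnatr_eq0 -lt0n card_setpart_gt0.
apply/eqP; rewrite eqn_leq min_card // andbT.
by apply/(card_refines F)/max_u; exists r.
Qed.

(** Without a maximum [HF0] is smaller by one or more than the least number of
    clusters, which is itself at most [#|X|]. *)
Lemma conflict_ratio_lt1 theta s t : (0 < #|X|)%N -> s <= t ->
  conflict0_in theta s t -> conflict_ratio theta s t <= 1 - #|X|%:R^-1.
Proof.
move=> X0 st conflict; have [r rst [min_r _]] := min_HF0_attained theta st.
have lt_card : (HF0 F theta s t < #|theta r|)%N.
  have [le_card eq_card] := HF0_leqif F theta rst.
  rewrite ltn_neqAle le_card andbT eq_card; apply/asboolP => max_r.
  apply: conflict; exists (theta r); first by exists r.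
  by move=> _ [r' r'st <-]; exact: max_r.
have n0 : 0 < #|theta r|%:R :> R by rewrite ltr0n card_setpart_gt0.
apply: (@le_trans _ _ (1 - #|theta r|%:R^-1)).
  rewrite /conflict_ratio min_r ler_pdivrMr // mulrBl mul1r mulVf ?gt_eqF //.
  by rewrite lerBrDr natr1 ler_nat.
by rewrite lerD2l lerN2 lef_pV2 ?posrE ?ltr0n ?ler_nat ?card_setpart_le
  ?card_setpart_gt0.
Qed.

(** * Persistence of conflicts *)

Section Sequence.
Variables (M : nat) (tp : nat -> R) (theta : R -> setpart X).
Hypothesis htheta : partition_sequence M tp theta.

Lemma change_point_lt m : (1 < m <= M)%N -> tp 1 < tp m.
Proof.
have [_ inc _ _] := htheta.
elim: m => // -[|m] IH // /andP[_ mM].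
have lt_m : tp m.+1 < tp m.+2 by apply: inc; rewrite mM.
case: m => [//|m] in IH mM lt_m *.
by apply: lt_trans lt_m; apply: IH; rewrite /= ltnW.
Qed.

Lemma right_constant t : tp 1 <= t ->
  exists2 e : R, 0 < e & forall u, t <= u -> u <= t + e -> theta u = theta t.
Proof.
have [M0 _ pc last_pc] := htheta => t1.
have [tM|tM] := leP (tp M) t.
  exists 1 => // u tu _; rewrite !last_pc //; exact: le_trans tM tu.
have [m mM /andP[tm tm1]] :
    exists2 m, (0 < m < M)%N & tp m <= t < tp m.+1.
  elim: M M0 tM => // -[|n] IH _ tn; first by rewrite ltNge t1 in tn.
  have [/IH[//|m /andP[m0 mn] tm]|tn1] := ltP t (tp n.+1).
    by exists m; rewrite // m0 ltnW.
  by exists n.+1; rewrite ?ltnSn // tn1.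
exists ((tp m.+1 - t) / 2); first by rewrite divr_gt0 // subr_gt0.
by move=> u tu ute; rewrite !(pc _ mM) //; apply/andP; split; lra.
Qed.

(** After the last change point theta takes no new value, so the interval of a
    conflict can be cut off there; this leaves room to its right below the upper
    end of the integral. *)
Lemma conflict0_before_last s t : tp 1 <= s -> s <= t ->
  conflict0_in theta s t ->
  exists t', [/\ s <= t', t' <= tp M & conflict0_in theta s t'].
Proof.
have [M0 _ _ last_pc] := htheta => s1 st conflict.
have [tM|Mt] := leP t (tp M); first by exists t.
have [Ms|sM] := leP (tp M) s.
  case: conflict; exists (theta s).
    by exists s; rewrite //= in_itv /= lexx.
  move=> Q [r /=]; rewrite in_itv /= => /andP[sr _] <-.
  by rewrite !last_pc // (le_trans Ms).
exists (tp M); split; rewrite ?(ltW sM) // => -[_ [r rsM <-] max_r].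
apply: conflict; exists (theta r).
  exists r => //=; move: rsM; rewrite /= !in_itv /= => /andP[-> rM].
  exact: le_trans rM (ltW Mt).
move=> Q [u /=]; rewrite in_itv /= => /andP[su ut] <-.
have [uM|Mu] := leP u (tp M).
  by apply: max_r; exists u; rewrite //= in_itv /= su.
rewrite last_pc ?(ltW Mu) //; apply: max_r.
by exists (tp M); rewrite //= in_itv /= lexx (ltW sM).
Qed.

(** Moving both ends of the interval slightly to the right does not change the
    set of values of theta, by [right_constant].  The two ends differ, since a
    single partition is its own maximum, so [e] can be chosen to keep the moved
    ends in order. *)
Lemma conflict0_rectangle s t (d : R) : tp 1 <= s -> s <= t -> 0 < d ->
  conflict0_in theta s t ->
  exists e : R, [/\ 0 < e, e <= d, s + e <= t &
    forall s' t', s' \in `[s, s + e] -> t' \in `[t, t + e] ->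
      conflict0_in theta s' t'].
Proof.
move=> s1 st d0 conflict.
have [es es0 cst_s] := right_constant s1.
have [et et0 cst_t] := right_constant (le_trans s1 st).
have lt_st : s < t.
  rewrite lt_neqAle st andbT; apply/eqP => eq_st; apply: conflict.
  exists (theta s); first by exists s; rewrite //= in_itv /= lexx.
  move=> Q [r /=]; rewrite in_itv /= -eq_st => rs <-.
  by rewrite (le_anti rs).
pose e := Num.min (Num.min es et) (Num.min d (t - s)).
have [e_es e_et e_d e_st] : [/\ e <= es, e <= et, e <= d & e <= t - s].
  by split; rewrite /e !ge_min lexx ?orbT.
exists e; split => //; [|lra|].
  by rewrite /e !lt_min es0 et0 d0 subr_gt0 lt_st.
move=> s' t'; rewrite !in_itv /= => /andP[ss' s'e] /andP[tt' t'e].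
suff -> : conflict0_in theta s' t' = conflict0_in theta s t by [].
rewrite /conflict0_in; congr (~ has_maximum _).
apply/seteqP; split=> Q [r /=]; rewrite in_itv /= => /andP[lo hi] <-.
  have [rt|tr] := leP r t.
    by exists r; rewrite //= in_itv /= rt andbT; lra.
  by exists t; [rewrite /= in_itv /= lexx andbT|apply/esym/cst_t; lra].
have [s'r|rs'] := leP s' r; first by exists r; rewrite //= in_itv /= s'r; lra.
exists s'; first by rewrite /= in_itv /= lexx; lra.
by rewrite !cst_s //; lra.
Qed.

(** * Vanishing and positivity of the average conflict *)

Lemma average_conflict0E : average_conflict0 F M tp theta =
  let T := tp M + (tp M - tp 1) / (M - 1)%:R in
  1 - 2 / `|T - tp 1| ^+ 2 *
    \int[lebesgue_measure]_(s in [set` `[tp 1, T]])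
      \int[lebesgue_measure]_(t in [set` `[s, T]]) conflict_ratio theta s t.
Proof. by []. Qed.

Hypotheses (X_gt0 : (0 < #|X|)%N) (M_gt1 : (1 < M)%N).

Let T : R := tp M + (tp M - tp 1) / (M - 1)%:R.

Lemma horizon_gt : tp 1 < tp M < T.
Proof.
have t1M : tp 1 < tp M by apply: change_point_lt; rewrite M_gt1 /=.
by rewrite t1M /T ltrDl divr_gt0 ?subr_gt0 // ltr0n subn_gt0.
Qed.

Lemma average_conflict0_eq0 : ~ conflict0 (tp 1) theta ->
  average_conflict0 F M tp theta = 0.
Proof.
move=> no_conflict; have /andP[t1M MT] := horizon_gt.
have t1T := lt_trans t1M MT.
rewrite average_conflict0E /= -/T Rintegral_triangle1 // => [|s t s1 st].
  2: by apply: conflict_ratio1 => // c; apply: no_conflict; exists s, t.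
by rewrite gtr0_norm ?subr_gt0 //; field; rewrite subr_eq0 gt_eqF.
Qed.

Lemma average_conflict0_gt0 : conflict0 (tp 1) theta ->
  0 < average_conflict0 F M tp theta.
Proof.
case=> s [t0 [s1 st0 /(conflict0_before_last s1 st0)[t [st tM conflict]]]].
have /andP[t1M MT] := horizon_gt.
have T_t : 0 < T - t by rewrite subr_gt0 (le_lt_trans tM).
have [e [e0 eT set_ rect]] := conflict0_rectangle s1 st T_t conflict.
rewrite average_conflict0E /= -/T.
set I := Rintegral _ _ _.
have k0 : 0 < #|X|%:R^-1 :> R by rewrite invr_gt0 ltr0n.
have I_le : I <= (T - tp 1) ^+ 2 / 2 - #|X|%:R^-1 * e ^+ 2.
  apply: (@le_Rintegral_rect R _ _ _ s t) => //; [by rewrite ltrDl|lra| |].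
    by move=> s' t' _ s't' _; exact: conflict_ratio01.
  move=> s' t' s'P t'P; apply: conflict_ratio_lt1 => //; last exact: rect.
  by move: s'P t'P; rewrite !in_itv /= => /andP[_ ?] /andP[? _]; lra.
have T2 : 0 < (T - tp 1) ^+ 2 by rewrite exprn_gt0 // subr_gt0; lra.
rewrite real_normK ?num_real // subr_gt0 mulrAC ltr_pdivrMr // mul1r.
have : 0 < #|X|%:R^-1 * e ^+ 2 by rewrite mulr_gt0 // exprn_gt0.
lra.
Qed.

End Sequence.

Lemma hierarchical_no_conflict theta (t1 : R) :
  strictly_hierarchical t1 theta -> ~ conflict0 t1 theta.
Proof.
have in1 r : t1 <= r -> r \in `[t1, +oo[ by rewrite in_itv /= andbT.
move=> hier [s [t [s1 st]]]; apply.
case: hier => mono.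
  exists (theta t); first by exists t; rewrite //= in_itv /= lexx andbT.
  move=> Q [r /=]; rewrite in_itv /= => /andP[sr rt] <-.
  by apply: mono => //; apply: in1; lra.
exists (theta s); first by exists s; rewrite //= in_itv /= lexx.
move=> Q [r /=]; rewrite in_itv /= => /andP[sr rt] <-.
by apply: mono => //; apply: in1; lra.
Qed.

(** The cluster space of [P] is a subspace of that of [Q], and at least as
    large. *)
Lemma refines_card_eq (P Q : setpart X) :
  (P <= Q)%O -> (#|P| <= #|Q|)%N -> P = Q.
Proof.
move=> PQ cardPQ; apply/le_anti; rewrite PQ -(cluster_space_le F) /=.
move: PQ; rewrite -(cluster_space_le F) => /dimv_leqif_sup[dimPQ <-].
rewrite eqn_leq dimPQ -(leq_add2r #|P|) dim_cluster_space.
by rewrite -(dim_cluster_space F Q) leq_add2l.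
Qed.

(** The maximum over [[s, t]] is refined by the partition at each end point, and
    the monotone number of clusters compares it with one of them the other way
    round. *)
Lemma no_conflict_hierarchical theta (t1 : R) :
  coarse_graining t1 theta \/ fine_graining t1 theta ->
  ~ conflict0 t1 theta -> strictly_hierarchical t1 theta.
Proof.
move=> graining no_conflict.
have max_ex s t : t1 <= s -> s <= t -> exists r, [/\ s <= r, r <= t &
    forall u, s <= u -> u <= t -> (theta u <= theta r)%O].
  move=> s1 st; have : ~ conflict0_in theta s t.
    by move=> conflict; apply: no_conflict; exists s, t.
  move=> /contrapT[Q [r /=]]; rewrite in_itv /= => /andP[sr rt] <- max_r.
  exists r; split => // u su ut; apply: max_r.
  by exists u; rewrite //= in_itv /= su.
case: graining => mono; [left|right] => s t;
  rewrite !in_itv /= !andbT => s1 t1t st.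
  have [r [sr rt max_r]] := max_ex s t s1 st.
  rewrite (@refines_card_eq (theta t) (theta r)); [exact: max_r|exact: max_r|].
  by apply: mono => //; lra.
have [r [sr rt max_r]] := max_ex s t s1 st.
rewrite (@refines_card_eq (theta s) (theta r)); [exact: max_r|exact: max_r|].
by apply: mono => //; lra.
Qed.

End ConflictRatio.

Theorem corollary9 (R : realType) (F : fieldType) (X : finType)
    (M : nat) (tp : nat -> R) (theta : R -> setpart X)
    (htheta : partition_sequence M tp theta) :
  [/\ forall s t : R, tp 1%N <= s -> s <= t -> hierarchical theta `[s, t] ->
        HF0 F theta s t = minn #|theta s| #|theta t|,
      forall t : R, tp 1%N <= t -> HF0 F theta t t = #|theta t|,
      (0 < #|X|)%N -> (2 <= M)%N ->
        (0 < average_conflict0 F M tp theta <-> conflict0 (tp 1%N) theta)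
    & (0 < #|X|)%N -> (2 <= M)%N ->
        coarse_graining (tp 1%N) theta \/ fine_graining (tp 1%N) theta ->
        (average_conflict0 F M tp theta = 0 <->
           strictly_hierarchical (tp 1%N) theta)].
Proof.
split=> [s t _|t _|X0 M1|X0 M1 graining].
- exact: HF0_hierarchical.
- exact: HF0_diag.
- split; last exact: average_conflict0_gt0.
  apply: contraPP => /(average_conflict0_eq0 F htheta X0 M1) ->.
  by rewrite ltxx.
split=> [avg0|/hierarchical_no_conflict]; last exact: average_conflict0_eq0.
apply: (no_conflict_hierarchical F graining).
move=> /(average_conflict0_gt0 F htheta X0 M1).
by rewrite avg0 ltxx.
Qed.
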